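(* Fix an integer $m\ge2$ and let $Z_n$ be the Zagreb index of the random caterpillar $C_n$. For $n\ge1$, $$\mathrm{Var}[Z_n]=\frac{(6m^3-22m^2+29m-16)n^4+O(n^3)}{(2m-1)^2(m-1)^2(2m+1)m}.$$
   Context: The Zagreb index of a finite graph $G=(V,E)$ is $\sum_{v\in V}(\deg(v))^2$. The random caterpillar $C_n$ with fixed spine size $m\ge2$ is defined as follows. At time $0$, $C_0$ is a path (the spine) on $m$ nodes labeled $1,\dots,m$ from one end to the other. At each time $n\ge1$, given $C_{n-1}$, a new leaf is joined by an edge to one spine node $j$, chosen with probability $D_{n-1,j}/\sum_{i=1}^mD_{n-1,i}=D_{n-1,j}/(n+2m-3)$, where $D_{n,j}$ denotes the degree of spine node $j$ in $C_n$. Thus the Zagreb index of $C_n$ is $Z_n=\sum_{j=1}^mD_{n,j}^2+n$. The $O(\cdot)$ notation is as $n\to\infty$ with $m$ fixed. *)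

(* Defs.v *)
From mathcomp Require Import all_boot all_order all_algebra.
From mathcomp Require Import all_classical all_reals all_analysis.

Set Implicit Arguments.
Unset Strict Implicit.
Unset Printing Implicit Defensive.

Import Order.TTheory GRing.Theory Num.Theory.
Import numFieldNormedType.Exports.

Local Open Scope classical_set_scope.
Local Open Scope ring_scope.

(* A finite simple graph is a symmetric irreflexive relation on a finType. *)
Definition deg (V : finType) (g : rel V) (v : V) : nat := #|[set w | g v w]%SET|.

Definition zagreb (V : finType) (g : rel V) : nat := (\sum_(v : V) deg g v ^ 2)%N.

(* The caterpillar with spine nodes [inl i], i : 'I_m, and leaves [inr k],
   k : 'I_n, in which leaf k hangs from spine node [s k].  Leaf k is the one
   that arrives at time k.+1, so only the values s 0, ..., s n.-1 matter. *)
Definition caterpillar (m n : nat) (s : nat -> 'I_m) : rel ('I_m + 'I_n) :=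
  fun u v =>
    match u, v with
    | inl i, inl j => (i.+1 == j :> nat) || (j.+1 == i :> nat)
    | inl i, inr k => s k == i
    | inr k, inl i => s k == i
    | inr _, inr _ => false
    end.

Lemma caterpillar_sym (m n : nat) (s : nat -> 'I_m) :
  symmetric (caterpillar (n := n) s).
Proof. by case=> [i|k] [j|l] //=; rewrite orbC. Qed.

Lemma caterpillar_irrefl (m n : nat) (s : nat -> 'I_m) :
  irreflexive (caterpillar (n := n) s).
Proof. by case=> [i|k] //=; rewrite gtn_eqF. Qed.

(* [J n w] is the spine node chosen for the leaf that turns C_n into C_{n+1}.
   [choice_law] says P(J n = j | C_n = g) = D_{n,j} / \sum_i D_{n,i}, with the
   degrees taken in g, multiplied out by P(C_n = g); it thus carries no content
   for the graphs g that C_n cannot reach. *)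
Record random_caterpillar (m : nat) (R : realType) (d : measure_display)
    (T : measurableType d) (P : probability T R) (J : nat -> T -> 'I_m)
    : Prop := RandomCaterpillar {
  measurable_choice : forall (n : nat) (j : 'I_m), measurable [set w | J n w = j];
  choice_law : forall (n : nat) (g : rel ('I_m + 'I_n)) (j : 'I_m),
    P [set w | caterpillar (n := n) (J^~ w) =2 g /\ J n w = j] =
    (P [set w | caterpillar (n := n) (J^~ w) =2 g] *
       ((deg g (inl j))%:R / \sum_(i < m) (deg g (inl i))%:R)%:E)%E
}.

Definition zagreb_caterpillar (m : nat) (R : realType) (T : Type)
    (J : nat -> T -> 'I_m) (n : nat) : T -> R :=
  fun w => (zagreb (caterpillar (n := n) (J^~ w)))%:R.

(* Main.v *)
(** The spine degrees form a Polya urn: a step raises one entry of the vector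
    [D], chosen proportionally to [D], so the total after [n] steps is the
    deterministic [t = n + 2m - 2].  A symmetric function [M] of [D] with
    [\sum_j D_j M(D + e_j) = (t + K) M(D)] has its mean multiplied by
    [(t + K) / t] at each step, hence [E[M(D_n)]] is proportional to the rising
    factorial [t (t + 1) ... (t + K - 1)].  Three such functions, of degrees 2,
    3, 4, span [Y = \sum_j D_j (D_j + 1)] and [Y ^ 2]; as
    [Z_n = Y - (2m - 2)], the variance of [Z_n] is that of [Y], which comes out
    as an explicit quartic polynomial in [n]. *)
Require Import Defs.
From mathcomp Require Import all_boot all_order all_algebra.
From mathcomp Require Import all_classical all_reals all_analysis.
From mathcomp Require Import ring lra zify.
Import Order.TTheory GRing.Theory Num.Theory.
Import numFieldNormedType.Exports.

Set Implicit Arguments.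
Unset Strict Implicit.
Unset Printing Implicit Defensive.

Local Open Scope classical_set_scope.
Local Open Scope ring_scope.

(** * Polynomial growth and expectations of finitely valued maps *)

Lemma horner_bigO (R : realType) (k : nat) (p : {poly R}) :
  (size p <= k.+1)%N ->
  (fun n : nat => p.[n%:R]) =O_\oo (fun n : nat => n%:R ^+ k : R).
Proof.
move=> sp; apply/eqO_exP.
(* For [n >= 1] each power of degree at most [k] is bounded by [n ^ k], so the absolute coefficients
   add up to a bound; the extra 1 keeps [C] positive when [p] is zero. *)
pose C : R := 1 + \sum_(i < k.+1) `|p`_i|.
exists C.
  by apply: ltr_wpDr ltr01; apply: sumr_ge0 => i _; exact: normr_ge0.
exists 1%N => // n /= n_gt0.
have n1 : 1 <= n%:R :> R by rewrite ler1n.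
rewrite (horner_coef_wide _ sp) /C mulrDl mul1r.
apply: le_trans (ler_norm_sum _ _ _) _.
apply: ler_wpDl; first exact: normr_ge0.
rewrite big_distrl; apply: ler_sum => i _.
rewrite normrM; apply: ler_wpM2l; first exact: normr_ge0.
rewrite !normrX ger0_norm ?ler0n //.
by rewrite ler_weXn2l // -ltnS.
Qed.

(** The integrand is a finite combination of indicators of the fibres of [h], so measurable fibres
    suffice and [U] needs no sigma-algebra. *)
Lemma expectation_finite (R : realType) (d : measure_display)
    (T : measurableType d) (P : probability T R) (U : finType) (h : T -> U)
    (F : U -> R) :
  (forall u, measurable [set w | h w = u]) ->
  ('E_P[fun w => F (h w)])%E = (\sum_u F u * fine (P [set w | h w = u]))%:E.
Proof.
move=> mh; rewrite unlock.
under eq_integral => w _.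
  have -> : (F (h w))%:E =
      (\sum_u (F u)%:E * (\1_[set w | h w = u] w)%:E)%E.
    rewrite (bigD1 (h w)) //= big1 ?adde0.
      by rewrite indicE mem_set //= mule1.
    by move=> u /eqP huw; rewrite indicE memNset ?mule0 //= => /esym.
  over.
rewrite integral_sum //; last first.
  by move=> u; apply: integrableZl => //; exact: integrable_indic.
rewrite -sumEFin; apply: eq_bigr => u _.
rewrite integralZl //; last exact: integrable_indic.
by rewrite integral_indic // setIT EFinM fineK // fin_num_measure.
Qed.

(** * Choice histories and spine degrees *)

Definition history (m n : nat) (s : nat -> 'I_m) : n.-tuple 'I_m :=
  [tuple s k | k < n].

Definition spine_deg (m n : nat) (s : nat -> 'I_m) (i : 'I_m) : nat :=
  deg (caterpillar (n := n) s) (inl i).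

Lemma history_eqP (m n : nat) (s s' : nat -> 'I_m) :
  history n s = history n s' <-> forall k : 'I_n, s k = s' k.
Proof.
split=> [e k|e]; last by apply: eq_from_tnth => k; rewrite !tnth_mktuple.
by have := congr1 (fun t => tnth t k) e; rewrite !tnth_mktuple.
Qed.

Lemma history_nth (m n : nat) (i0 : 'I_m) (t : n.-tuple 'I_m) :
  history n (nth i0 t) = t.
Proof. by apply: eq_from_tnth => k; rewrite tnth_mktuple -tnth_nth. Qed.

(** Each leaf has exactly one neighbour, so the labelled graph determines all choices. Conditioning
    on the graph thus amounts to conditioning on a value in a finite type. *)
Lemma caterpillar_history (m n : nat) (s s' : nat -> 'I_m) :
  caterpillar (n := n) s =2 caterpillar s' <-> history n s = history n s'.
Proof.
rewrite history_eqP; split=> [e k|e [i|k] [j|l]] //=; last 2 first.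
- by rewrite e.
- by rewrite e.
by have /= := e (inl (s k)) (inr k); rewrite eqxx => /esym/eqP.
Qed.

Lemma spine_deg_history (m n : nat) (s s' : nat -> 'I_m) :
  history n s = history n s' -> spine_deg n s = spine_deg n s'.
Proof.
move=> /caterpillar_history e; apply/funext => i.
by rewrite /spine_deg /deg; apply: eq_card => v; rewrite !inE e.
Qed.

Lemma card_set_sum (A B : finType) (p : pred (A + B)) :
  #|[set x | p x]%SET| = (\sum_a p (inl a) + \sum_b p (inr b))%N.
Proof. by rewrite -sum1dep_card big_mkcond big_sumType. Qed.

Lemma spine_degE (m n : nat) (s : nat -> 'I_m) (i : 'I_m) :
  spine_deg n s i = ((0 < i) + (i.+1 < m) + \sum_(k < n) (s k == i))%N.
Proof.
rewrite /spine_deg /deg card_set_sum /=; congr (_ + _)%N.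
(* The factor [0 < i] cancels the spurious left neighbour at [i = 0], where [i.-1] truncates to
   0. *)
have -> : (\sum_(a < m) ((i.+1 == a) || (a.+1 == i))%N =
    \sum_(a < m) (a == i.-1 :> nat) * (0 < i)%N +
    \sum_(a < m) (a == i.+1 :> nat))%N.
  rewrite -big_split /=; apply: eq_bigr => a _.
  by do !case: eqP => //=; lia.
rewrite -big_distrl /=.
have count k : (\sum_(a < m) (a == k :> nat) = (k < m))%N.
  case: (ltnP k m) => km.
    rewrite (bigD1 (Ordinal km)) //= eqxx big1 // => a.
    by rewrite -val_eqE /= => /negPf ->.
  by rewrite big1 // => a _; have := ltn_ord a; case: eqP => //=; lia.
rewrite !count; have := ltn_ord i; case: (val i) => [|k] /=; lia.
Qed.

Lemma spine_degS (m n : nat) (s : nat -> 'I_m) :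
  spine_deg n.+1 s = fun i => (spine_deg n s i + (i == s n))%N.
Proof.
by apply/funext => i; rewrite !spine_degE big_ord_recr /= addnA (eq_sym i).
Qed.

Lemma sum_spine_deg0 (m : nat) (hm : (2 <= m)%N) (s : nat -> 'I_m)
    (V : nmodType) (f : nat -> V) :
  \sum_i f (spine_deg 0 s i) = f 1%N *+ 2 + f 2%N *+ (m - 2).
Proof.
case: m hm s => [|[|m]] // _ s.
rewrite big_ord_recl big_ord_recr /= addrCA addrA.
rewrite !spine_degE !big_ord0 !subn2 /=.
rewrite /bump /= !add1n ltnn -addrA addrC; congr (_ + _).
under eq_bigr => i _.
  rewrite spine_degE big_ord0 /= /bump /= add1n !ltnS ltn_ord.
  over.
by rewrite sumr_const card_ord.
Qed.

Lemma sum_spine_deg (m n : nat) (hm : (2 <= m)%N) (s : nat -> 'I_m) :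
  (\sum_i spine_deg n s i = n + (2 * m - 2))%N.
Proof.
elim: n => [|n IH].
  have natmulE (a b : nat) : a *+ b = (a * b)%N by rewrite -mulr_natr natn.
  by rewrite (sum_spine_deg0 hm s id) !natmulE; lia.
rewrite spine_degS big_split /= IH (bigD1 (s n)) //= eqxx big1; last first.
  by move=> i /negPf ->.
lia.
Qed.

Lemma zagreb_caterpillarE (m n : nat) (s : nat -> 'I_m) :
  zagreb (caterpillar (n := n) s) = (\sum_i spine_deg n s i ^ 2 + n)%N.
Proof.
rewrite /zagreb big_sumType /=; congr (_ + _)%N.
rewrite -[RHS]card_ord -sum1_card; apply: eq_bigr => k _.
rewrite /deg card_set_sum /= [X in (_ + X)%N]big1 // addn0.
by rewrite (bigD1 (s k)) //= eqxx big1 // => i; rewrite eq_sym => /negPf ->.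
Qed.

(** * Growth of rising moments under one urn step *)

Lemma sum_incr (m : nat) (V : zmodType) (f : nat -> V) (x : 'I_m -> nat)
    (j : 'I_m) :
  \sum_i f (x i + (i == j))%N = \sum_i f (x i) + (f (x j).+1 - f (x j)).
Proof.
rewrite (bigD1 j) //= [in RHS](bigD1 j) //= eqxx addn1.
rewrite (eq_bigr (fun i => f (x i))); last first.
  by move=> i /negPf ->; rewrite addn0.
by rewrite [in RHS]addrAC subrKC.
Qed.

Lemma sum_weighted_affine (R : comNzRingType) (I : finType) (x : I -> nat)
    (a : R) (g : I -> R) :
  \sum_j (x j)%:R * (a + g j) = (\sum_j x j)%:R * a + \sum_j (x j)%:R * g j.
Proof.
rewrite natr_sum big_distrl -big_split; apply: eq_bigr => j _.
by rewrite /= mulrDr.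
Qed.

Definition rise2 (R : nzRingType) (k : nat) : R := k%:R * (k%:R + 1).
Definition rise3 (R : nzRingType) (k : nat) : R :=
  k%:R * (k%:R + 1) * (k%:R + 2).

Definition mom2 (R : nzRingType) (m : nat) (x : 'I_m -> nat) : R :=
  \sum_i rise2 R (x i).
Definition mom3 (R : nzRingType) (m : nat) (x : 'I_m -> nat) : R :=
  \sum_i rise3 R (x i).
(* Equals [\sum_i x_i(x_i+1)(x_i+2)(x_i+3) + \sum_(i != j) x_i(x_i+1)x_j(x_j+1)],
   the combination of degree-four rising moments whose top-degree part is that
   of [mom2 ^+ 2]. *)
Definition mom4 (R : nzRingType) (m : nat) (x : 'I_m -> nat) : R :=
  mom2 R x ^+ 2 + 4 * mom3 R x - 2 * mom2 R x.

Lemma mom2_incr (R : comNzRingType) (m : nat) (x : 'I_m -> nat) (j : 'I_m) :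
  mom2 R (fun i => x i + (i == j))%N = mom2 R x + 2 * ((x j)%:R + 1).
Proof.
rewrite /mom2 (sum_incr (rise2 R)); congr (_ + _).
by rewrite /rise2 -natr1; ring.
Qed.

Lemma mom3_incr (R : comNzRingType) (m : nat) (x : 'I_m -> nat) (j : 'I_m) :
  mom3 R (fun i => x i + (i == j))%N =
  mom3 R x + 3 * (((x j)%:R + 1) * ((x j)%:R + 2)).
Proof.
rewrite /mom3 (sum_incr (rise3 R)); congr (_ + _).
by rewrite /rise3 -natr1; ring.
Qed.

(** An increment of entry [k] raises [rise2] by [2 (k + 1)]; weighting by [k] returns [2 * rise2 k].
    The same mechanism gives the factor 3 for [rise3]. *)
Lemma mom2_growth (R : comNzRingType) (m : nat) (x : 'I_m -> nat) :
  \sum_j (x j)%:R * mom2 R (fun i => x i + (i == j))%N =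
  ((\sum_j x j)%:R + 2) * mom2 R x.
Proof.
rewrite (eq_bigr _ (fun j _ => congr1 _ (mom2_incr R x j))).
rewrite sum_weighted_affine mulrDl; congr (_ + _).
rewrite [RHS]big_distrr; apply: eq_bigr => j _ /=.
by rewrite /rise2; ring.
Qed.

Lemma mom3_growth (R : comNzRingType) (m : nat) (x : 'I_m -> nat) :
  \sum_j (x j)%:R * mom3 R (fun i => x i + (i == j))%N =
  ((\sum_j x j)%:R + 3) * mom3 R x.
Proof.
rewrite (eq_bigr _ (fun j _ => congr1 _ (mom3_incr R x j))).
rewrite sum_weighted_affine mulrDl; congr (_ + _).
rewrite [RHS]big_distrr; apply: eq_bigr => j _ /=.
by rewrite /rise3; ring.
Qed.

Lemma mom4_growth (R : comNzRingType) (m : nat) (x : 'I_m -> nat) :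
  \sum_j (x j)%:R * mom4 R (fun i => x i + (i == j))%N =
  ((\sum_j x j)%:R + 4) * mom4 R x.
Proof.
pose M := mom2 R x.
(* Increment of [mom4] at [j]: the squared jump [4 (x j + 1) ^ 2] of [mom2] is rewritten in rising
   products, which turns the coefficients 12 and -4 into 16 and -8. *)
pose g j : R := 4 * M * ((x j)%:R + 1) +
  (16 * (((x j)%:R + 1) * ((x j)%:R + 2)) - 8 * ((x j)%:R + 1)).
have mom4_incr j : mom4 R (fun i => x i + (i == j))%N = mom4 R x + g j.
  by rewrite /mom4 mom2_incr mom3_incr /g /M; ring.
rewrite (eq_bigr _ (fun j _ => congr1 _ (mom4_incr j))).
rewrite sum_weighted_affine mulrDl; congr (_ + _).
have -> : 4 * mom4 R x = 4 * M * mom2 R x + (16 * mom3 R x - 8 * mom2 R x).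
  by rewrite /mom4 /M; ring.
clear mom4_incr; clearbody M; rewrite /mom2 /mom3 !big_distrr -sumrB -big_split.
by apply: eq_bigr => j _; rewrite /= /g /rise2 /rise3; ring.
Qed.

(** * Means along the random caterpillar *)

Section RandomCaterpillar.
Context (R : realType) (m : nat) (hm : (2 <= m)%N) (d : measure_display).
Context (T : measurableType d) (P : probability T R) (J : nat -> T -> 'I_m).
Context (hJ : random_caterpillar P J).

Let i0 : 'I_m := Ordinal (ltnW hm).

Lemma measurable_history (n : nat) (t : n.-tuple 'I_m) :
  measurable [set w | history n (J^~ w) = t].
Proof.
have -> : [set w | history n (J^~ w) = t] =
    \bigcap_(k in [set: 'I_n]) [set w | J k w = tnth t k].
  apply/seteqP; split=> w /= => [<- k _|e]; first by rewrite /= tnth_mktuple.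
  by apply: eq_from_tnth => k; rewrite tnth_mktuple e.
by apply: fin_bigcap_measurable => // k _; exact: (measurable_choice hJ).
Qed.

(* [nth i0 t] extends [t] to an infinite sequence; its degrees at time [n] do
   not depend on the default [i0]. *)
Definition mean (n : nat) (F : ('I_m -> nat) -> R) : R :=
  \sum_(t : n.-tuple 'I_m) F (spine_deg n (nth i0 t)) *
    fine (P [set w | history n (J^~ w) = t]).

Lemma expectation_mean (n : nat) (F : ('I_m -> nat) -> R) :
  ('E_P[fun w => F (spine_deg n (J^~ w))])%E = (mean n F)%:E.
Proof.
rewrite /mean -(expectation_finite P (fun t : n.-tuple _ => F (spine_deg n (nth i0 t))));
  last exact: measurable_history.
congr expectation; apply/funext => w; congr F; apply: spine_deg_history.
by rewrite history_nth.
Qed.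

Lemma meanD (n : nat) (F G : ('I_m -> nat) -> R) :
  mean n (fun x => F x + G x) = mean n F + mean n G.
Proof.
by rewrite -big_split; apply: eq_bigr => t _; rewrite mulrDl.
Qed.

Lemma meanZ (n : nat) (a : R) (F : ('I_m -> nat) -> R) :
  mean n (fun x => a * F x) = a * mean n F.
Proof. by rewrite big_distrr; apply: eq_bigr => t _; rewrite /= mulrA. Qed.

Lemma mean_cst (n : nat) (a : R) : mean n (fun=> a) = a.
Proof.
apply/EFin_inj; rewrite -expectation_mean.
rewrite unlock integral_cst // -[RHS]mule1; congr (_ * _)%E.
exact: probability_setT.
Qed.

(** Only the empty history exists at time 0, and [s] is arbitrary because no leaf has been
    attached. *)
Lemma mean0 (F : ('I_m -> nat) -> R) (s : nat -> 'I_m) :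
  mean 0 F = F (spine_deg 0 s).
Proof.
rewrite -[RHS](mean_cst 0); apply: eq_bigr => t _; congr (F _ * _).
by apply: spine_deg_history; apply: eq_from_tnth => -[].
Qed.

Lemma history_choice_law (n : nat) (t : n.-tuple 'I_m) (j : 'I_m) :
  fine (P [set w | history n (J^~ w) = t /\ J n w = j]) =
  fine (P [set w | history n (J^~ w) = t]) *
    ((spine_deg n (nth i0 t) j)%:R / (n + (2 * m - 2))%:R).
Proof.
have := choice_law hJ (caterpillar (n := n) (nth i0 t)) j.
have e w : (caterpillar (n := n) (J^~ w) =2 caterpillar (nth i0 t)) =
    (history n (J^~ w) = t).
  by apply/propext; rewrite caterpillar_history history_nth.
under eq_set => w do rewrite e.
under [in X in _ = X -> _]eq_set => w do rewrite e.
rewrite -natr_sum sum_spine_deg // => ->.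
by rewrite fineM // fin_num_measure //; exact: measurable_history.
Qed.

Lemma mean_step (n : nat) (F : ('I_m -> nat) -> R) :
  mean n.+1 F = mean n (fun x => \sum_j
    (x j)%:R / (n + (2 * m - 2))%:R * F (fun i => x i + (i == j))%N).
Proof.
apply/EFin_inj; rewrite -expectation_mean.
(* The pair of past history and new choice takes finitely many values and determines the next spine
   degrees; summing over it conditions on the past. *)
pose h w := (history n (J^~ w), J n w).
pose G (u : n.-tuple 'I_m * 'I_m) :=
  F (fun i => spine_deg n (nth i0 u.1) i + (i == u.2))%N.
have hE u : [set w | h w = u] =
    [set w | history n (J^~ w) = u.1 /\ J n w = u.2].
  by case: u => t j; apply/seteqP; split=> w; rewrite /h /= => -[<- <-].
transitivity (('E_P[fun w => G (h w)])%E).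
  congr expectation; apply/funext => w; rewrite spine_degS /G /=.
  by rewrite (spine_deg_history (history_nth i0 (history n (J^~ w)))).
rewrite expectation_finite; last first.
  move=> u; rewrite hE; apply: measurableI; first exact: measurable_history.
  exact: (measurable_choice hJ).
congr EFin; under eq_bigr => u _ do rewrite hE.
rewrite -(pair_bigA _ (fun t j => G (t, j) *
  fine (P [set w | history n (J^~ w) = t /\ J n w = j]))) /=.
apply: eq_bigr => t _; rewrite big_distrl; apply: eq_bigr => j _ /=.
by rewrite history_choice_law /G /=; ring.
Qed.

Lemma mean_growth (K : nat) (F : ('I_m -> nat) -> R) :
  (forall x : 'I_m -> nat,
    \sum_j (x j)%:R * F (fun i => x i + (i == j))%N =
    ((\sum_j x j)%:R + K%:R) * F x) ->
  forall n, mean n.+1 F =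
    ((n + (2 * m - 2))%:R + K%:R) / (n + (2 * m - 2))%:R * mean n F.
Proof.
move=> hF n; rewrite mean_step -meanZ; apply: eq_bigr => t _; congr (_ * _).
rewrite -(sum_spine_deg n hm (nth i0 t)).
rewrite [RHS]mulrAC -hF [RHS]mulrC big_distrr; apply: eq_bigr => j _ /=.
by rewrite mulrA; congr (_ * _); exact: mulrC.
Qed.

(** The growth factors telescope to a ratio of rising factorials, stated here cross-multiplied. *)
Lemma mean_rising (K : nat) (F : ('I_m -> nat) -> R) (s : nat -> 'I_m) :
  (forall x : 'I_m -> nat,
    \sum_j (x j)%:R * F (fun i => x i + (i == j))%N =
    ((\sum_j x j)%:R + K%:R) * F x) ->
  forall n, mean n F * \prod_(k < K) (2 * m - 2 + k)%:R =
    F (spine_deg 0 s) * \prod_(k < K) (n + (2 * m - 2) + k)%:R.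
Proof.
move=> hF; elim=> [|n IH]; first by rewrite (mean0 _ s).
rewrite (mean_growth hF) -[LHS]mulrA IH mulrCA; congr (_ * _).
have t0 : (n + (2 * m - 2))%:R != 0 :> R by rewrite pnatr_eq0; lia.
rewrite mulrAC; apply: (canLR (mulfK t0)); rewrite mulrC [RHS]mulrC.
(* Both sides are the same product of [K + 1] consecutive factors, split at its last or at its first
   factor. *)
transitivity (\prod_(k < K.+1) (n + (2 * m - 2) + k)%:R : R).
  by rewrite big_ord_recr /= -natrD.
rewrite big_ord_recl /= addn0; congr (_ * _).
by apply: eq_bigr => k _; rewrite /= /bump add1n addnS addSn.
Qed.

Lemma variance_zagreb (n : nat) :
  'V_P[zagreb_caterpillar R J n] =
  (mean n (mom4 R (m:=m)) - 4 * mean n (mom3 R (m:=m)) +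
    2 * mean n (mom2 R (m:=m)) - mean n (mom2 R (m:=m)) ^+ 2)%:E.
Proof.
(* The squared degrees sum to [mom2] minus the total degree [n + (2m - 2)], and the [n] leaves
   cancel that [n]. *)
pose F (x : 'I_m -> nat) : R := mom2 R x - (2 * m - 2)%:R.
have zE : zagreb_caterpillar R J n = fun w => F (spine_deg n (J^~ w)).
  apply/funext => w; rewrite /zagreb_caterpillar zagreb_caterpillarE /F.
  rewrite (_ : mom2 R _ = \sum_i (spine_deg n (J^~ w) i ^ 2)%:R +
    (\sum_i spine_deg n (J^~ w) i)%:R); last first.
    rewrite natr_sum -big_split; apply: eq_bigr => i _.
    by rewrite /= /rise2 natrX mulrDr mulr1 expr2.
  by rewrite sum_spine_deg // !natrD natr_sum; ring.
have muF : mean n F = mean n (mom2 R (m := m)) - (2 * m - 2)%:R.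
  by rewrite (meanD n (mom2 R (m := m))) mean_cst.
rewrite /variance unlock zE expectation_mean.
set mu := mean n (mom2 R (m := m)) in muF *.
(* The squared deviation is [(mom2 - mu) ^ 2]; replacing [mom2 ^ 2] by [mom4 - 4 mom3 + 2 mom2]
   makes it linear in the three moments. *)
rewrite (_ : (_ * _)%R = fun w => (fun x => mom4 R x + (- 4 * mom3 R x +
    ((2 - 2 * mu) * mom2 R x + mu ^+ 2))) (spine_deg n (J^~ w))); last first.
  by apply/funext => w; rewrite !fctE /= muF /F /mom4; ring.
rewrite (expectation_mean n (fun x => mom4 R x + (- 4 * mom3 R x +
    ((2 - 2 * mu) * mom2 R x + mu ^+ 2)))).
rewrite !meanD !meanZ mean_cst -/mu; congr EFin.
ring.
Qed.

End RandomCaterpillar.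

(** * Initial values and the explicit variance *)

Lemma mom_spine_deg0 (R : comNzRingType) (m : nat) (hm : (2 <= m)%N)
    (s : nat -> 'I_m) :
  (mom2 R (spine_deg 0 s) = 6 * m%:R - 8) *
  (mom3 R (spine_deg 0 s) = 24 * m%:R - 36).
Proof.
have sumE (f : nat -> R) :
    \sum_i f (spine_deg 0 s i) = f 1%N *+ 2 + f 2%N * (m%:R - 2).
  by rewrite (sum_spine_deg0 hm) -natrB // mulr_natr.
by rewrite /mom2 /mom3 !sumE; split; rewrite /rise2 /rise3; ring.
Qed.

Theorem corollary3 (R : realType) (m : nat) (hm : (2 <= m)%N) :
  exists r : nat -> R,
    (r =O_\oo (fun n : nat => n%:R ^+ 3 : R)) /\
    forall (d : measure_display) (T : measurableType d) (P : probability T R)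
      (J : nat -> T -> 'I_m),
      random_caterpillar P J ->
      forall n : nat, (1 <= n)%N ->
        'V_P[zagreb_caterpillar R J n] =
        (((6 * m%:R ^+ 3 - 22 * m%:R ^+ 2 + 29 * m%:R - 16) * n%:R ^+ 4 + r n) /
         ((2 * m%:R - 1) ^+ 2 * (m%:R - 1) ^+ 2 * (2 * m%:R + 1) * m%:R))%:E.
Proof.
set x : R := m%:R.
(* [a] is the total spine degree at time 0, and [y0], [w0], [q0] are the initial values of [mom2],
   [mom3], [mom4]. *)
pose a := 2 * x - 2.
pose y0 := 6 * x - 8.
pose w0 := 24 * x - 36.
pose q0 := y0 ^+ 2 + 4 * w0 - 2 * y0.
(* With [t = n + a], the variance times the denominator, which is
   [a^2 (a+1)^2 (a+2) (a+3) / 8], equals [q t(t+1)(t+2)(t+3) - w t(t+1)(t+2)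
   + u t(t+1) - v (t(t+1))^2 = b4 t^4 + b3 t^3 + b2 t^2 + b1 t]. *)
pose q := q0 * a * (a + 1) / 8.
pose w := w0 * a * (a + 1) * (a + 3) / 2.
pose u := y0 * a * (a + 1) * (a + 2) * (a + 3) / 4.
pose v := y0 ^+ 2 * (a + 2) * (a + 3) / 8.
pose b4 := 6 * x ^+ 3 - 22 * x ^+ 2 + 29 * x - 16.
pose b3 := 6 * q - w - 2 * v.
pose b2 := 11 * q - 3 * w + u - v.
pose b1 := 6 * q - 2 * w + u.
(* Coefficients in [n] of the quartic in [t = n + a], with [b4 n ^ 4] removed; four coefficients
   mean degree at most 3. *)
pose p := Poly [:: b4 * a ^+ 4 + b3 * a ^+ 3 + b2 * a ^+ 2 + b1 * a;
  4 * b4 * a ^+ 3 + 3 * b3 * a ^+ 2 + 2 * b2 * a + b1;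
  6 * b4 * a ^+ 2 + 3 * b3 * a + b2;
  4 * b4 * a + b3].
exists (fun n => p.[n%:R]); split; first by apply: horner_bigO; exact: size_Poly.
move=> d T P J hJ n _.
have x2 : 2 <= x by rewrite /x ler_nat.
have aE : (2 * m - 2)%:R = a by rewrite natrB ?natrM //; lia.
have a0 : a != 0 by rewrite /a; apply/negP => /eqP; lra.
pose s := fun _ : nat => Ordinal (ltnW hm).
have y0E : mom2 R (spine_deg 0 s) = y0 by rewrite mom_spine_deg0.
have w0E : mom3 R (spine_deg 0 s) = w0 by rewrite mom_spine_deg0.
have q0E : mom4 R (spine_deg 0 s) = q0 by rewrite /mom4 y0E w0E.
have a1 : a + 1 != 0 by rewrite /a; apply/negP => /eqP; lra.
have a2 : a + 2 != 0 by rewrite /a; apply/negP => /eqP; lra.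
have a3 : a + 3 != 0 by rewrite /a; apply/negP => /eqP; lra.
pose t := n%:R + a.
have mean2 : mean hm P J n (mom2 R (m := m)) =
    y0 * (t * (t + 1)) / (a * (a + 1)).
  apply: (canRL (mulfK _)); first by rewrite mulf_neq0.
  have := mean_rising hm hJ s (@mom2_growth R m) n.
  by rewrite !big_ord_recl !big_ord0 y0E !natrD aE !addr0 !mulr1.
have mean3 : mean hm P J n (mom3 R (m := m)) =
    w0 * (t * (t + 1) * (t + 2)) / (a * (a + 1) * (a + 2)).
  apply: (canRL (mulfK _)); first by rewrite !mulf_neq0.
  have := mean_rising hm hJ s (@mom3_growth R m) n.
  by rewrite !big_ord_recl !big_ord0 w0E !natrD aE !addr0 !mulr1 !mulrA.
have mean4 : mean hm P J n (mom4 R (m := m)) =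
    q0 * (t * (t + 1) * (t + 2) * (t + 3)) /
    (a * (a + 1) * (a + 2) * (a + 3)).
  apply: (canRL (mulfK _)); first by rewrite !mulf_neq0.
  have := mean_rising hm hJ s (@mom4_growth R m) n.
  by rewrite !big_ord_recl !big_ord0 q0E !natrD aE !addr0 !mulr1 !mulrA.
rewrite (variance_zagreb hm hJ) mean2 mean3 mean4; congr EFin.
rewrite -/b4 /p horner_Poly /=.
transitivity ((b4 * t ^+ 4 + b3 * t ^+ 3 + b2 * t ^+ 2 + b1 * t) /
  ((2 * x - 1) ^+ 2 * (x - 1) ^+ 2 * (2 * x + 1) * x)); last first.
  by congr (_ / _); rewrite /t; ring.
(* The terms [y0 ^ 2 a ^ 2 / 8] cancel in [q - v], which leaves a cubic in [m]. *)
have -> : b4 = q - v by rewrite /b4 /q /v /q0 /y0 /w0 /a; field.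
have xE : x = (a + 2) / 2 by rewrite /a; field.
have -> : (2 * x - 1) ^+ 2 * (x - 1) ^+ 2 * (2 * x + 1) * x =
    a ^+ 2 * (a + 1) ^+ 2 * (a + 2) * (a + 3) / 8.
  by rewrite xE; field.
(* The remaining identity holds for independent [a], [y0], [w0], [q0], [t], so their values are
   forgotten before [field]. *)
rewrite /b3 /b2 /b1 /q /w /u /v; clearbody a y0 w0 q0 t; field.
by rewrite a0 a1 a2 a3.
Qed.
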